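(* Let $\{r_\xi:\xi<\omega_1\}\subseteq[0,1]$ consist of distinct points, let $(f_\xi)_{\xi<\omega_1}$ be an anti-Ramsey sequence of continuous functions $f_\xi:[0,1]\setminus\{r_\xi\}\to[-1,1]$, and let $K\subseteq[0,1]^{\{*\}}\times[-1,1]^{\omega_1}$ be the connectedly split interval induced by $(f_\xi)_{\xi<\omega_1}$. Then the Banach space $C(K)$ has no uncountable equilateral set, and for every $\varepsilon>0$ the unit ball of $C(K)$ contains no uncountable $(1+\varepsilon)$-separated set.
   Context: $C(K)$ is the Banach space of real-valued continuous functions on the compact Hausdorff space $K$ with the supremum norm. For $r\in\mathbb{R}$, a subset $A$ of a Banach space is $r$-separated if $\|v_1-v_2\|>r$ for all distinct $v_1,v_2\in A$, and $r$-equilateral if $\|v_1-v_2\|=r$ for all distinct $v_1,v_2\in A$; it is equilateral if it is $r$-equilateral for some $r\in\mathbb{R}$. Connectedly split interval: let $\kappa\le 2^{\omega}$ be a cardinal, let $r_\xi$ ($\xi<\kappa$) be distinct elements of $[0,1]$, and let $f_\xi:[0,1]\setminus\{r_\xi\}\to[-1,1]$ be continuous for every $\xi<\kappa$. The connectedly split interval induced by $(f_\xi)_{\xi<\kappa}$ is the subspace $K$ of the product $[0,1]^{\{*\}}\times[-1,1]^\kappa$ (one coordinate called $*$ with values in $[0,1]$, and coordinates $\xi<\kappa$ with values in $[-1,1]$) consisting of the points $x_{\xi,t}$ for $\xi<\kappa$, $t\in[-1,1]$, and $x_r$ for $r\in[0,1]\setminus\{r_\xi:\xi<\kappa\}$,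 where: $x_{\xi,t}( * )=r_\xi$, $x_{\xi,t}(\xi)=t$, and $x_{\xi,t}(\eta)=f_\eta(r_\xi)$ for $\eta\in\kappa\setminus\{\xi\}$; and $x_r( * )=r$, $x_r(\xi)=f_\xi(r)$ for all $\xi<\kappa$. Anti-Ramsey sequence: let $\kappa$ be an uncountable cardinal, $r_\xi\in[0,1]$ ($\xi<\kappa$) distinct, and $f_\xi:[0,1]\setminus\{r_\xi\}\to[-1,1]$ continuous. The sequence $(f_\xi)_{\xi<\kappa}$ is anti-Ramsey if, given (a) $m\in\mathbb{N}$, (b) pairwise disjoint nonempty open intervals $I_1,\dots,I_m$ of $[0,1]$ with rational endpoints, (c) any sequence $(F_\alpha)_{\alpha<\omega_1}$ of pairwise disjoint finite subsets $F_\alpha=\{\xi_1^\alpha,\dots,\xi_m^\alpha\}$ of $\kappa$ such that $r_{\xi_i^\alpha}\in I_i$ for all $1\le i\le m$ and $\alpha<\omega_1$, and (d) any two $m$-tuples $(q_1,\dots,q_m)$, $(q_1',\dots,q_m')$ of rationals from $[-1,1]$, there are $\alpha<\beta<\omega_1$ and open intervals $(J_i^\alpha)_{1\le i\le m}$, $(J_i^\beta)_{1\le i\le m}$ such that for each $1\le i\le m$: (1) $J_i^\alpha,J_i^\beta\subseteq I_i$ and $J_i^\alpha\cap J_i^\beta=\emptyset$; (2) $r_{\xi_i^\alpha}\in J_i^\alpha$ and $r_{\xi_i^\beta}\in J_i^\beta$; (3) $f_{\xi_i^\alpha}$ and $f_{\xi_i^\beta}$ have the same restriction to $[0,1]\setminus(J_i^\alpha\cup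 J_i^\beta)$, i.e. they agree at every point of $[0,1]$ lying outside the union of the two intervals $J_i^\alpha$ and $J_i^\beta$; (4) $f_{\xi_i^\alpha}$ is constantly equal to $q_i$ on $J_i^\beta$; (5) $f_{\xi_i^\beta}$ is constantly equal to $q_i'$ on $J_i^\alpha$. *)

(* Defs.v *)
From HB Require Import structures.
From mathcomp Require Import all_boot all_order all_algebra.
From mathcomp Require Import all_classical all_reals all_analysis.
From mathcomp Require Import ring.
Import Order.TTheory GRing.Theory Num.Theory.
Import numFieldNormedType.Exports.

Set Implicit Arguments.
Unset Strict Implicit.
Unset Printing Implicit Defensive.

Local Open Scope classical_set_scope.
Local Open Scope ring_scope.

HB.mixin Record isCompactHausdorff T & Topological T := {
  compact_hausdorff_compact : compact [set: T];
  compact_hausdorff_hausdorff : hausdorff_space T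
}.

#[short(type="compactHausdorffType")]
HB.structure Definition CompactHausdorff :=
  {T of Topological T & isCompactHausdorff T}.

Definition CK (R : realType) (K : compactHausdorffType) : Type :=
  continuousType K R.

HB.instance Definition _ (R : realType) (K : compactHausdorffType) :=
  Choice.copy (CK R K) (continuousType K R).

Section CK_lmodule.
Context {R : realType} {K : compactHausdorffType}.
Implicit Types (g h : CK R K) (a : R).

Definition CK_fun (g : CK R K) : K -> R := g.

Lemma CK_cts g : continuous (CK_fun g). Proof. exact: cts_fun. Qed.

Lemma CK_eqP g h : CK_fun g =1 CK_fun h -> g = h.
Proof. by move=> gh; apply/continuousEP. Qed.

Definition CK_mk (u : K -> R) (cu : continuous u) : CK R K := mkcts cu.

Fact CK_zero_cts : continuous (fun _ : K => 0 : R).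
Proof. by move=> x; exact: cvg_cst. Qed.

Fact CK_opp_cts g : continuous (fun x => - CK_fun g x).
Proof. by move=> x; apply: cvgN; exact: CK_cts. Qed.

Fact CK_add_cts g h : continuous (fun x => CK_fun g x + CK_fun h x).
Proof. by move=> x; apply: cvgD; exact: CK_cts. Qed.

Fact CK_scale_cts a g : continuous (fun x => a * CK_fun g x).
Proof. by move=> x; apply: cvgM; [exact: cvg_cst|exact: CK_cts]. Qed.

Definition CK_zero : CK R K := CK_mk CK_zero_cts.
Definition CK_opp g : CK R K := CK_mk (@CK_opp_cts g).
Definition CK_add g h : CK R K := CK_mk (@CK_add_cts g h).
Definition CK_scale a g : CK R K := CK_mk (@CK_scale_cts a g).

Fact CK_addA : associative CK_add.
Proof. by move=> f g h; apply: CK_eqP => x; exact: addrA. Qed.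
Fact CK_addC : commutative CK_add.
Proof. by move=> f g; apply: CK_eqP => x; exact: addrC. Qed.
Fact CK_add0 : left_id CK_zero CK_add.
Proof. by move=> f; apply: CK_eqP => x; exact: add0r. Qed.
Fact CK_addN : left_inverse CK_zero CK_opp CK_add.
Proof. by move=> f; apply: CK_eqP => x; exact: addNr. Qed.

HB.instance Definition _ :=
  GRing.isZmodule.Build (CK R K) CK_addA CK_addC CK_add0 CK_addN.

Fact CK_scaleA a b g : CK_scale a (CK_scale b g) = CK_scale (a * b) g.
Proof. by apply: CK_eqP => x; exact: mulrA. Qed.
Fact CK_scale1 : left_id 1 CK_scale.
Proof. by move=> f; apply: CK_eqP => x; exact: mul1r. Qed.
Fact CK_scaleDr : right_distributive CK_scale +%R.
Proof. by move=> a f g; apply: CK_eqP => x; exact: mulrDr. Qed.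
Fact CK_scaleDl g : {morph CK_scale^~ g : a b / a + b}.
Proof. by move=> a b; apply: CK_eqP => x; exact: mulrDl. Qed.

HB.instance Definition _ := GRing.Zmodule_isLmodule.Build R (CK R K)
  CK_scaleA CK_scale1 CK_scaleDr CK_scaleDl.

Lemma CK_addE g h x : CK_fun (g + h) x = CK_fun g x + CK_fun h x.
Proof. by []. Qed.
Lemma CK_oppE g x : CK_fun (- g) x = - CK_fun g x.
Proof. by []. Qed.
Lemma CK_scaleE a g x : CK_fun (a *: g) x = a * CK_fun g x.
Proof. by []. Qed.

Definition CK_norm g : R := sup [set `|CK_fun g x| | x in [set: K]].

Lemma CK_bounded g : has_ubound [set `|CK_fun g x| | x in [set: K]].
Proof.
have cg : compact (CK_fun g @` [set: K]).
  apply: continuous_compact; last exact: compact_hausdorff_compact.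
  by apply: continuous_subspaceT; exact: CK_cts.
have [M [_ hM]] : bounded_set (CK_fun g @` [set: K]).
  exact: (@compact_bounded R R _ cg).
exists (M + 1) => _ [x _ <-].
by apply: (hM (M + 1)) => /=; [rewrite ltrDl|exists x].
Qed.

Lemma CK_le_norm g x : `|CK_fun g x| <= CK_norm g.
Proof. by apply: ub_le_sup; [exact: CK_bounded|exists x]. Qed.

Lemma CK_norm_ge0 g : 0 <= CK_norm g.
Proof.
have [[x _]|K0] := pselect ([set: K] !=set0).
  exact: le_trans (CK_le_norm g x).
rewrite /CK_norm (_ : [set `|CK_fun g x| | x in setT] = set0) ?sup0//.
by apply/seteqP; split=> // y [x _ _]; apply: K0; exists x.
Qed.

Lemma CK_norm_le g a : 0 <= a ->
  (CK_norm g <= a) <-> (forall x, `|CK_fun g x| <= a).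
Proof.
move=> a0; split=> [ga x|ga]; first exact: le_trans (CK_le_norm g x) ga.
have [[x _]|K0] := pselect ([set: K] !=set0).
  by apply: ge_sup => [|_ [y _ <-]//]; exists `|CK_fun g x|, x.
rewrite /CK_norm (_ : [set `|CK_fun g x| | x in setT] = set0) ?sup0//.
by apply/seteqP; split=> // y [x _ _]; apply: K0; exists x.
Qed.

Fact CK_ler_normD g h : CK_norm (g + h) <= CK_norm g + CK_norm h.
Proof.
apply/CK_norm_le => [|x]; first by rewrite addr_ge0// CK_norm_ge0.
by rewrite CK_addE (le_trans (ler_normD _ _))// lerD// CK_le_norm.
Qed.

Fact CK_normrZ a g : CK_norm (a *: g) = `|a| * CK_norm g.
Proof.
apply/eqP; rewrite eq_le; apply/andP; split.
  apply/CK_norm_le => [|x]; first by rewrite mulr_ge0// CK_norm_ge0.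
  by rewrite CK_scaleE normrM ler_wpM2l// CK_le_norm.
have [->|a0] := eqVneq a 0; first by rewrite normr0 mul0r CK_norm_ge0.
rewrite -ler_pdivlMl ?normr_gt0//.
apply/CK_norm_le => [|x]; first by rewrite mulr_ge0// ?invr_ge0// CK_norm_ge0.
rewrite ler_pdivlMl ?normr_gt0// -normrM -CK_scaleE; exact: CK_le_norm.
Qed.

Fact CK_normr0_eq0 g : CK_norm g = 0 -> g = 0.
Proof.
move=> g0; apply: CK_eqP => x; apply/eqP.
by rewrite -normr_le0 -g0 CK_le_norm.
Qed.

HB.instance Definition _ := Lmodule_isNormed.Build R (CK R K)
  CK_ler_normD CK_normrZ CK_normr0_eq0.

Lemma CK_normE g : `|g| = sup [set `|CK_fun g x| | x in [set: K]].
Proof. by []. Qed.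

Fact CK_complete (F : set_system (CK R K)) :
  ProperFilter F -> cauchy F -> cvg F.
Proof.
move=> FF /cauchy_ballP Fc.
have diam (e : R) : 0 < e -> exists2 A, F A &
    forall g h, A g -> A h -> forall x, `|CK_fun g x - CK_fun h x| <= e.
  move=> e0; have [[P Q] /= [FP FQ] PQ] := Fc e e0.
  exists (P `&` Q); first exact: filterI.
  move=> g h [Pg _] [_ Qh] x; have := PQ (g, h) (conj Pg Qh).
  rewrite /= -ball_normE/= => /ltW gh.
  exact: le_trans (CK_le_norm (g - h) x) gh.
have Fx x : cvg (CK_fun g x @[g --> F]).
  apply/cauchy_cvgP/cauchy_exP => e e0.
  have [|A FA hA] := diam (e / 2); first by rewrite divr_gt0.
  have [g Ag] := filter_ex FA; exists (CK_fun g x).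
  suff: F [set h | ball (CK_fun g x) e (CK_fun h x)] by [].
  apply: filterS FA => h Ah; rewrite /= -ball_normE/=.
  apply: le_lt_trans (hA _ _ Ag Ah x) _.
  by rewrite ltr_pdivrMr// ltr_pMr// ltr1n.
pose f x := lim (CK_fun g x @[g --> F]).
have key (e : R) : 0 < e ->
    \forall g \near F, forall x, `|f x - CK_fun g x| <= e.
  move=> /diam[A AF hA]; apply: filterS (AF) => g Ag x.
  have : CK_fun h x - CK_fun g x @[h --> F] --> f x - CK_fun g x.
    by apply: cvgB; [exact: Fx|exact: cvg_cst].
  move/cvg_norm; apply: (@closed_cvg _ _ F _ _ [set z | z <= e]).
    exact: closed_le.
  by apply: filterS AF => h Ah; exact: hA.
have cf : continuous f.
  move=> x; apply/cvgrPdist_le => e e0.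
  have e3 : 0 < e / 3 by rewrite divr_gt0.
  have [g hg] := filter_ex (key _ e3).
  have /cvgrPdist_le/(_ _ e3) : CK_fun g y @[y --> x] --> CK_fun g x.
    exact: CK_cts.
  apply: filterS => y gy.
  rewrite (_ : f x - f y = (f x - CK_fun g x) + (CK_fun g x - CK_fun g y)
    - (f y - CK_fun g y)); last by rewrite addrA subrK opprB addrA subrK.
  rewrite (le_trans (ler_normB _ _))//.
  rewrite (_ : e = e / 3 + e / 3 + e / 3); last by field.
  by rewrite lerD// (le_trans (ler_normD _ _))// lerD.
apply/cvg_ex; exists (CK_mk cf); apply/cvgrPdist_le => e e0.
apply: filterS (key e e0) => g hg; apply/CK_norm_le => //; exact: ltW.
Qed.

HB.instance Definition _ := Uniform_isComplete.Build (CK R K) CK_complete.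

End CK_lmodule.

Section separated_sets.
Context {R : realType} {V : normedModType R}.
Implicit Types (r : R) (A : set V).

Definition r_separated r A :=
  forall v1 v2, A v1 -> A v2 -> v1 <> v2 -> r < `|v1 - v2|.

Definition r_equilateral r A :=
  forall v1 v2, A v1 -> A v2 -> v1 <> v2 -> `|v1 - v2| = r.

Definition equilateral A := exists r, r_equilateral r A.

End separated_sets.

(* The values of [sf_fun i] outside [0, 1] minus [sf_point i] are junk; no
   definition below depends on them. *)
Record splitting_family (R : realType) (X : choiceType) := SplittingFamily {
  sf_point : X -> R;
  sf_fun : X -> R -> R;
  sf_point_inj : injective sf_point;
  sf_point01 : forall i, `[0, 1]%classic (sf_point i);
  sf_fun_cts : forall i,
    {within `[0, 1] `\ sf_point i, continuous (sf_fun i)};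
  sf_fun_itv : forall i x, (`[0, 1] `\ sf_point i) x ->
    `[-1, 1]%classic (sf_fun i x)
}.

Section connectedly_split_interval.
Context {R : realType} {X : choiceType} (S : splitting_family R X).
Local Notation r := (sf_point S).
Local Notation f := (sf_fun S).

(* The first component is the coordinate *, the second one lists the others.
   The product of [0, 1] and the copies of [-1, 1] is seen as a subspace of
   R * R^X, which induces the same topology on the points considered. *)
Definition csi_split_point (i : X) (t : R) : R * {ptws X -> R} :=
  (r i, fun j => if j == i then t else f j (r i)).

Definition csi_point (x : R) : R * {ptws X -> R} := (x, fun j => f j x).

Definition csi_set : set (R * {ptws X -> R}) :=
  [set p | exists i t, `[-1, 1]%classic t /\ p = csi_split_point i t] `|`
  [set csi_point x | x in `[0, 1] `\` range r].

Definition csi : Type := set_type csi_set.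

HB.instance Definition _ := Topological.copy csi (set_type csi_set).

Let box : set (R * {ptws X -> R}) :=
  `[0, 1] `*` [set y | forall j, `[-1, 1]%classic (y j)].

Lemma csi_coordE p j : csi_set p -> p.1 != r j -> p.2 j = f j p.1.
Proof.
move=> [[i [t [_ ->]]]|[x _ <-]]//=.
by case: (eqVneq j i) => // ->; rewrite eqxx.
Qed.

Lemma csi_box : csi_set `<=` box.
Proof.
move=> _ [[i [t [tI ->]]]|[x [xI xr] <-]]; split => /=.
- exact: (sf_point01 S).
- move=> j; case: eqVneq => // ji; apply: (sf_fun_itv (s := S)).
  split; first exact: (sf_point01 S).
  by move=> /= /(@sf_point_inj _ _ S) ij; rewrite ij eqxx in ji.
- exact: xI.
- move=> j; apply: (sf_fun_itv (s := S)); split => //= xj.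
  by apply: xr; exists j.
Qed.

Lemma csi_setE : csi_set =
  box `&` [set p | forall j, p.1 != r j -> p.2 j = f j p.1].
Proof.
apply/seteqP; split=> [p Kp|[x y] [[/= xI yI] h]].
  by split; [exact: csi_box|move=> j; exact: csi_coordE].
have [[i _ ix]|xr] := pselect (range r x).
  left; exists i, (y i); split; first exact: yI.
  rewrite /csi_split_point ix; apply: (f_equal2 pair) => //.
  apply/funext => j; case: eqVneq => [->//|ji].
  by apply: h; rewrite -ix eq_sym; apply: contra_neq ji => /(@sf_point_inj _ _ S).
right; exists x => //; apply: (f_equal2 pair) => //; apply/funext => j; apply/esym/h.
by apply/eqP => xj; apply: xr; exists j.
Qed.

Lemma ptws_coord_cts (j : X) :
  continuous (fun p : R * {ptws X -> R} => p.2 j).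
Proof.
move=> p; apply: (@cvg_comp _ _ _ snd (fun y : {ptws X -> R} => y j)).
  exact: cvg_snd.
exact: (@proj_continuous X (fun=> R) j).
Qed.

Lemma box_compact : compact box.
Proof.
apply: compact_setX; first exact: segment_compact.
have c1 : compact (`[-1, 1]%classic : set R) by exact: segment_compact.
exact: (@tychonoff X (fun=> R) (fun=> `[-1, 1]%classic) (fun=> c1)).
Qed.

Lemma box_closed : closed box.
Proof.
rewrite (_ : box = fst @^-1` `[0, 1] `&`
    \bigcap_j ((fun p : R * {ptws X -> R} => p.2 j) @^-1` `[-1, 1])).
  apply: closedI.
    by apply: preimage_closed; [move=> p _; exact: cvg_fst|exact: itv_closed].
  apply: closed_bigI => j _.
  by apply: preimage_closed; [move=> p _; exact: ptws_coord_cts|exact: itv_closed].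
by apply/seteqP; split=> p [p1 p2]; split=> // j; [move=> _|]; exact: p2.
Qed.

Lemma csi_closed : closed csi_set.
Proof.
move=> p clKp; rewrite csi_setE; split.
   by apply: box_closed; apply: closureS clKp; exact: csi_box.
move=> j pj.
have FF : ProperFilter (within csi_set (nbhs p)) by exact/within_nbhs_proper.
have fc : continuous (@fst R {ptws X -> R}) by move=> z; exact: cvg_fst.
have p1 : q.1 @[q --> within csi_set (nbhs p)] --> p.1.
  by move=> U /fc; apply: (@cvg_within _ (nbhs p)).
have p2 : q.2 j @[q --> within csi_set (nbhs p)] --> p.2 j.
  by move=> U /ptws_coord_cts; apply: (@cvg_within _ (nbhs p)).
have pI : `[0, 1]%classic p.1.
  by have [] := box_closed (closureS csi_box clKp).
have Kq : within csi_set (nbhs p) csi_set by exact: withinT.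
have qj : within csi_set (nbhs p) (fst @^-1` [set x | x != r j]).
  by apply: p1; apply: open_nbhs_nbhs; split => //; exact: open_neq.
have fp : f j q.1 @[q --> within csi_set (nbhs p)] --> f j p.1.
  have /subspace_continuousP/(_ p.1) := @sf_fun_cts _ _ S j.
  move=> /(_ (conj pI (elimN eqP pj))) fj U /fj pU.
  have Uq := p1 _ pU.
  suff : within csi_set (nbhs p) [set q | U (f j q.1)] by [].
  apply: filterS3 qj Kq Uq => q /= qj Kq; apply; split; last exact/eqP.
  by have [] := csi_box Kq.
apply: (cvg_unique (@Rhausdorff R)) p2 _.
apply: cvg_trans fp; apply: near_eq_cvg.
by apply: filterS2 Kq qj => q Kq qj; apply/esym; exact: csi_coordE.
Qed.

Fact csi_compact : compact [set: csi].
Proof.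
have cK : compact csi_set.
  exact: subclosed_compact csi_closed box_compact csi_box.
move=> F FF _.
have FK : (set_val @ F) csi_set.
  suff : F (set_val @^-1` csi_set) by [].
  by apply: filterS filterT => q _; exact: (set_mem (valP q)).
have [p [Kp clp]] := cK _ (fmap_proper_filter set_val FF) FK.
exists (exist _ p (mem_set Kp)); split => // A B FA [/= _ [[C oC <-] Cp] CB].
have FA' : F (set_val @^-1` (set_val @` A)).
  by apply: filterS FA => a Aa; exists a.
have [_ [[a Aa <-] Ca]] := clp _ _ FA' (open_nbhs_nbhs (conj oC Cp)).
by exists a; split => //; exact: CB.
Qed.


Fact csi_hausdorff : hausdorff_space csi.
Proof.
have cv : continuous (set_val : csi -> R * {ptws X -> R}).
  exact: initial_continuous.
have sep (g : R * {ptws X -> R} -> R) (p q : csi) : continuous g ->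
    cluster (nbhs p) q -> g (set_val p) = g (set_val q).
  move=> cg pq; apply: (@Rhausdorff R) => A B /cg/cv pA /cg/cv qB.
  have [z [Az Bz]] := pq _ _ pA qB.
  by exists (g (set_val z)).
move=> p q pq.
have e1 : (set_val p).1 = (set_val q).1.
  by apply: (sep fst) pq => z; exact: cvg_fst.
have e2 : (set_val p).2 = (set_val q).2.
  by apply/funext => j; apply: (sep (fun z => z.2 j)) pq; exact: ptws_coord_cts.
case: p q e1 e2 {pq} => [[p1 p2] hp] [[q1 q2] hq] /= e1 e2.
by apply: val_inj; exact: (f_equal2 pair e1 e2).
Qed.

HB.instance Definition _ :=
  isCompactHausdorff.Build csi csi_compact csi_hausdorff.

End connectedly_split_interval.

Section anti_ramsey.
Context {R : realType}.

(* Open intervals of the space [0, 1]: intervals such as [0, 1/2), open in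
   [0, 1] but not in R, are included. *)
Definition open_interval01 (J : set R) :=
  exists a b : R, J = `]a, b[ `&` `[0, 1].

Definition rat_open_interval01 (I : set R) :=
  exists a b : rat, I = `]ratr a, ratr b[ `&` `[0, 1].

(* [W] stands for omega_1 (see [is_omega1]) and [X] for the uncountable index
   set kappa. The finite set F_a is the range of [xi a]; its enumeration is
   injective because the intervals [I i] are pairwise disjoint. *)
Definition anti_ramsey (d : Order.disp_t) (W : orderType d) (X : choiceType)
    (S : splitting_family R X) :=
  forall (m : nat) (I : 'I_m -> set R),
    (forall i, rat_open_interval01 (I i)) -> (forall i, I i !=set0) ->
    trivIset [set: 'I_m] I ->
  forall xi : W -> 'I_m -> X,
    trivIset [set: W] (fun a => range (xi a)) ->
    (forall a i, I i (sf_point S (xi a i))) ->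
  forall q q' : 'I_m -> rat,
    (forall i, -1 <= q i <= 1) -> (forall i, -1 <= q' i <= 1) ->
  exists a b : W, (a < b)%O /\ exists J J' : 'I_m -> set R,
    (forall i, open_interval01 (J i) /\ open_interval01 (J' i)) /\
    forall i,
      [/\ [/\ J i `<=` I i, J' i `<=` I i & J i `&` J' i = set0],
          J i (sf_point S (xi a i)) /\ J' i (sf_point S (xi b i)),
          forall x, (`[0, 1] `\` (J i `|` J' i)) x ->
            sf_fun S (xi a i) x = sf_fun S (xi b i) x,
          forall x, J' i x -> sf_fun S (xi a i) x = ratr (q i) &
          forall x, J i x -> sf_fun S (xi b i) x = ratr (q' i)].

End anti_ramsey.

(* These properties characterise the order type omega_1. *)
Definition is_omega1 (d : Order.disp_t) (W : orderType d) :=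
  [/\ well_founded (fun a b : W => (a < b)%O),
      ~ countable [set: W] &
      forall a : W, countable [set b : W | (b < a)%O]].

(* Main.v *)
Require Import Defs.
From mathcomp Require Import all_boot all_order all_algebra.
From mathcomp Require Import all_classical all_reals all_analysis.
From mathcomp Require Import ring lra.
Import Order.TTheory GRing.Theory Num.Theory.
Import numFieldNormedType.Exports.

(** Take an uncountable family in C(K).  Up to a small error, each of its
    members depends only on the base coordinate in [0, 1] and on finitely many
    fibre coordinates in [-1, 1], since K is compact and its points are
    separated by their coordinates ([continuous_finite_coords]).  A
    Delta-system argument and pigeonhole arguments over countable sets of data
    then extract omega_1 many members g_a that look alike
    ([coherent_family]).  They have a finite root of coordinates in common, and
    each g_a has m private coordinates xi_a(0), ..., xi_a(m - 1), which no
    other member uses and whose split points lie in fixed disjoint rational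
    intervals I_0, ..., I_(m - 1).  At a point whose base lies in I_i, the value
    of g_a is nearly psi_i(t), where t is the i-th private coordinate and psi_i
    is a continuous function on [-1, 1] that does not depend on a.  Where the
    private coordinates of g_a and g_b agree, g_a and g_b nearly agree.

    The anti-Ramsey property provides a < b such that the i-th private
    coordinates of g_a and g_b agree except over two small intervals in I_i,
    one around each of the two split points; over the interval of the other
    one, each of them takes a prescribed rational value q_i.  Two choices of
    q_i give opposite estimates ([anti_ramsey_oscillation]).

    If q_i is near a point t, then, along the fibre over the split point of
    g_a, the difference g_a - g_b is nearly psi_i(s) - psi_i(t) at height s.
    Hence distances as large as the oscillation of psi_i occur.

    If every psi_i(q_i) is near the midpoint of the range of psi_i, then g_a
    and g_b differ by at most about half of the largest oscillation.  Such q_i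
    exist by the intermediate value theorem, because the fibre [-1, 1] is
    connected ([rat_midrange]).

    In an r-equilateral family the first estimate bounds the oscillations by
    about r, and the second one then yields r <= r / 2 up to a small error,
    which is absurd.  In the unit ball the oscillations are at most 2, and the
    second estimate yields two members at distance at most 1 + eps. *)

Local Open Scope classical_set_scope.
Local Open Scope ring_scope.

(** * Uncountable families *)

Lemma countable_subset {T : Type} (A B : set T) :
  A `<=` B -> countable B -> countable A.
Proof. by move=> AB; apply: sub_countable; exact: subset_card_le. Qed.

Lemma uncountable_fiber {T : Type} {C : countType} {A : set T} (c : T -> C) :
  ~ countable A -> exists y, ~ countable (A `&` [set t | c t = y]).
Proof.
move=> A_unc; apply: contrapT => no_y; apply: A_unc.
apply: (@countable_subset _ _ (\bigcup_(y in setT) (A `&` [set t | c t = y]))).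
  by move=> t At; exists (c t).
apply: bigcup_countable => // y _; apply: contrapT => fy_unc.
by apply: no_y; exists y.
Qed.

(** The form of the Delta-system lemma used below: outside of a finite root [D],
    a point lies in only countably many of the finite sets.  While some [x0]
    lies in uncountably many of them, it is put into the root and removed from
    these sets, which become smaller. *)
Lemma delta_root {T : Type} {X : choiceType} {A : set T} (n : nat)
    (F : T -> seq X) :
  ~ countable A -> (forall t, A t -> (size (F t) <= n)%N) ->
  exists (D : seq X) (B : set T), [/\ B `<=` A, ~ countable B &
    forall x, x \notin D -> countable (B `&` [set t | x \in F t])].
Proof.
elim: n A F => [|n IHn] A F A_unc FA.
  exists nil, A; split=> // x _; apply: (@countable_subset _ _ set0).
    by move=> t [At /=]; move: (FA t At); case: (F t).
  exact: countable0.
have [small|] := pselect (forall x, countable (A `&` [set t | x \in F t])).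
  by exists nil, A; split.
move=> /existsNP[x0 A0_unc].
pose F' t := [seq x <- F t | x != x0].
have [|D [B [BA B_unc BD]]] := IHn _ F' A0_unc.
  move=> t [At /= x0t]; have := FA t At; rewrite /F' size_filter.
  rewrite -(count_predC (pred1 x0) (F t)).
  have : (0 < count (pred1 x0) (F t))%N by rewrite -has_count has_pred1.
  by case: count => // k _; rewrite addSn ltnS; apply: leq_trans; exact: leq_addl.
exists (x0 :: D), B; split=> //; first by move=> t /BA[].
move=> x; rewrite inE negb_or => /andP[xx0 xD].
apply: countable_subset (BD x xD) => t [Bt /= xF]; split=> //=.
by rewrite mem_filter xx0.
Qed.

(** The values are chosen by recursion along omega_1: the countably many earlier
    values conflict with countably many members of [A] in all, so an
    uncountable set has a member left. *)
Lemma transfinite_avoid {d : Order.disp_t} {W : orderType d} {T : choiceType}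
    (conflict : T -> T -> Prop) {A : set T} :
  is_omega1 W -> ~ countable A ->
  (forall t, A t -> countable (A `&` [set s | conflict t s])) ->
  exists2 f : W -> T, (forall a, A (f a)) &
    forall a b, (a < b)%O -> ~ conflict (f a) (f b).
Proof.
move=> [wf _ W_seg] A_unc A_conf.
have next (a : W) (f : forall b : W, (b < a)%O -> T) :
    exists t, (forall b (ba : (b < a)%O), A (f b ba)) ->
      A t /\ forall b (ba : (b < a)%O), ~ conflict (f b ba) t.
  (* The recursion step has to be total, so it must also return a value when
     the earlier ones are not in [A]. *)
  have [fA|nfA] := pselect (forall b (ba : (b < a)%O), A (f b ba)); last first.
    have [t At] : A !=set0.
      apply: contrapT => /set0P/negP; rewrite negbK => /eqP A0.
      by apply: A_unc; rewrite A0; exact: countable0.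
    by exists t.
  pose F (b : W) : set T := [set s | A s /\
    exists ba : (b < a)%O, conflict (f b ba) s].
  have Fc : countable (\bigcup_(b in [set b | (b < a)%O]) F b).
    apply: bigcup_countable => // b /= ba.
    apply: countable_subset (A_conf _ (fA b ba)) => s [As [ba' fs]].
    by split=> //=; rewrite (bool_irrelevance ba ba').
  have [t [At nFt]] : exists t, A t /\ ~ (\bigcup_(b in [set b | (b < a)%O]) F b) t.
    apply: contrapT => no_t; apply: A_unc; apply: countable_subset Fc => t At.
    by apply: contrapT => nFt; apply: no_t; exists t.
  exists t => _; split=> // b ba fbt; apply: nFt; exists b => //.
  by split=> //; exists ba.
pose f := Fix wf (fun=> T) (fun a g => projT1 (cid (next a g))).
have fE a : f a = projT1 (cid (next a (fun b _ => f b))).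
  rewrite /f Fix_eq // => b g h gh; congr (projT1 (cid (next b _))).
  by apply: functional_extensionality_dep => c; apply: functional_extensionality_dep => cb.
have fP a : (forall b, (b < a)%O -> A (f b)) ->
    A (f a) /\ forall b, (b < a)%O -> ~ conflict (f b) (f a).
  by rewrite (fE a); case: cid => t /= h; exact: h.
have fA a : A (f a).
  by elim/(well_founded_ind wf): a => a IHa; have [] := fP a IHa.
exists f => // a b ab; by have [_] := fP b (fun c _ => fA c); exact.
Qed.

(** * A pigeonhole principle for graphs of bounded functions *)

(** The index of the cell of mesh [1 / N] of the interval [[-N, N]] that
    contains [v]. *)
Definition grid_cell {R : realType} (N : nat) (v : R) : 'I_(N * N).*2.+1 :=
  inord (Num.truncn ((v + N%:R) * N%:R)).

Lemma grid_cell_close {R : realType} {N : nat} {v w : R} :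
  `|v| <= N%:R -> `|w| <= N%:R -> grid_cell N v = grid_cell N w ->
  `|v - w| * N%:R < 1.
Proof.
have Pos (x : R) : `|x| <= N%:R -> 0 <= (x + N%:R) * N%:R.
  rewrite ler_norml => /andP[Nx _]; apply: mulr_ge0 => //; lra.
have cellE (x : R) : `|x| <= N%:R ->
    grid_cell N x = Num.truncn ((x + N%:R) * N%:R) :> nat.
  move=> xN; rewrite /grid_cell inordK // ltnS.
  have := truncn_itv (Pos x xN) => /andP[tx _].
  rewrite -(ler_nat R); apply: le_trans tx _.
  rewrite -addnn natrD natrM -mulrDl; apply: ler_wpM2r => //.
  by move: xN; rewrite ler_norml => /andP[_ xN]; lra.
move=> vN wN /(congr1 (@nat_of_ord _)); rewrite !cellE // => e.
have /andP[v1 v2] := truncn_itv (Pos v vN).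
have /andP[w1 w2] := truncn_itv (Pos w wN).
move: v1 v2 w1 w2; rewrite e -[X in _ < X -> _]natr1 => v1 v2 w1 w2.
have N0 : 0 <= N%:R :> R by [].
rewrite -{1}(ger0_norm N0) -normrM ltr_norml mulrBl.
move: v1 v2 w1 w2; rewrite !mulrDl -natr1 => *; lra.
Qed.

(** A bounded graph meets only finitely many cells of a grid, so the set of the
    cells that it meets takes countably many values when the size of the grid
    varies; two graphs that meet the same cells of a fine grid are close. *)
Lemma uncountable_close_graphs {R : realType} {T X : Type} {J : finType}
    (u : T -> X -> J -> R) {A : set T} {delta : R} :
  0 < delta -> ~ countable A ->
  (forall t, A t -> exists M, forall x j, `|u t x j| <= M) ->
  exists B : set T, [/\ B `<=` A, ~ countable B &
    forall t s x, B t -> B s -> exists y, forall j, `|u t x j - u s y j| < delta].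
Proof.
move=> delta0 A_unc u_bnd.
have /choice[N hN] : forall t, exists N : nat, A t ->
    (forall x j, `|u t x j| <= N%:R) /\ delta^-1 <= N%:R.
  move=> t; have [At|] := pselect (A t); last by exists 0%N.
  have [M hM] := u_bnd t At; exists (Num.bound (`|M| + delta^-1)) => _.
  have d0 : 0 <= delta^-1 by rewrite invr_ge0 ltW.
  have : `|M| + delta^-1 < (Num.bound (`|M| + delta^-1))%:R.
    by apply: archi_boundP; rewrite addr_ge0.
  move: (Num.bound _)%:R => b hb; split; last by have := normr_ge0 M; lra.
  by move=> x j; apply: le_trans (hM x j) _; have := ler_norm M; lra.
have [n An_unc] := uncountable_fiber N A_unc.
pose cells t x : {ffun J -> 'I_(n * n).*2.+1} := [ffun j => grid_cell n (u t x j)].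
pose c t := [set p | `[< exists x, p = cells t x >]]%SET.
have [C B_unc] := uncountable_fiber c An_unc.
exists (A `&` [set t | N t = n] `&` [set t | c t = C]); split=> //.
  by move=> t [[]].
move=> t s x [[At /= Nt] /= ct] [[As /= Ns] /= cs].
have : cells t x \in c s.
  by rewrite cs -ct inE; apply/asboolP; exists x.
rewrite inE => /asboolP[y xy]; exists y => j.
have [ut nd] := hN t At; have [us _] := hN s As; rewrite Nt in ut nd; rewrite Ns in us.
have cell_eq : grid_cell n (u t x j) = grid_cell n (u s y j).
  by have /ffunP/(_ j) := xy; rewrite !ffunE.
have close := grid_cell_close (ut x j) (us y j) cell_eq.
have n0 : 0 < n%:R :> R by apply: lt_le_trans nd; rewrite invr_gt0.
move: close; rewrite -ltr_pdivlMr // div1r => /lt_le_trans; apply.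
by rewrite -[leRHS]invrK lef_pV2 // posrE ?invr_gt0.
Qed.

(** * Coordinates on the split interval *)

Section csi_coordinates.
Context {R : realType} {X : choiceType} (S : splitting_family R X).
Local Notation r := (sf_point S).
Local Notation f := (sf_fun S).
Implicit Types (x y : csi S) (i j : X).

Definition base x : R := (set_val x).1.
Definition coord x j : R := (set_val x).2 j.

Lemma base_continuous : continuous base.
Proof.
move=> x; apply: (@cvg_comp _ _ _ (set_val : csi S -> _) fst).
  exact: initial_continuous.
exact: cvg_fst.
Qed.

Lemma coord_continuous j : continuous (coord ^~ j).
Proof.
move=> x; apply: (@cvg_comp _ _ _ (set_val : csi S -> _) (fun p => p.2 j)).
  exact: initial_continuous.
exact: ptws_coord_cts.
Qed.

Lemma csi_setP x : csi_set S (set_val x).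
Proof. exact: set_mem (valP x). Qed.

Lemma base_itv x : `[0, 1]%classic (base x).
Proof. by have [] := csi_box (csi_setP x). Qed.

Lemma coord_itv x j : -1 <= coord x j <= 1.
Proof. by have [_ /(_ j)] := csi_box (csi_setP x); rewrite /= in_itv. Qed.

Lemma coordE x j : base x != r j -> coord x j = f j (base x).
Proof. exact: csi_coordE (csi_setP x). Qed.

Lemma csi_eq x y : base x = base y -> coord x =1 coord y -> x = y.
Proof.
move=> e1 e2; apply: val_inj; move: e1 e2; rewrite /base /coord /set_val /=.
case: (val x) (val y) => [x1 x2] [y1 y2] /= -> e2.
by congr pair; apply/funext.
Qed.

(** Makes the fibre parametrization [fiber_pt] below total. *)
Definition clamp (t : R) : R := Num.max (-1) (Num.min 1 t).

Lemma clamp_itv t : -1 <= clamp t <= 1.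
Proof. by rewrite /clamp le_max lexx /= ge_max ge_min lexx /= andbT; lra. Qed.

Lemma clamp_id t : -1 <= t <= 1 -> clamp t = t.
Proof. by case/andP=> t1 t2; rewrite /clamp min_r // max_r. Qed.

Lemma clamp_dist s t : `|clamp s - clamp t| <= `|s - t|.
Proof.
have := ler_norm (s - t); have := ler_norm (- (s - t)); rewrite normrN ler_norml.
rewrite /clamp; case: (leP 1 s) => ?; case: (leP 1 t) => ?;
  case: (leP (-1 : R) 1) => ?; try (case: (leP (-1 : R) s) => ?);
  try (case: (leP (-1 : R) t) => ?); lra.
Qed.

Lemma fiber_pt_subproof i t : csi_split_point S i (clamp t) \in csi_set S.
Proof.
by apply/mem_set; left; exists i, (clamp t); split=> //=; rewrite in_itv /= clamp_itv.
Qed.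

Definition fiber_pt i t : csi S :=
  exist (fun p => p \in csi_set S) _ (fiber_pt_subproof i t).

Lemma base_fiber_pt i t : base (fiber_pt i t) = r i. Proof. by []. Qed.

Lemma coord_fiber_pt i t : coord (fiber_pt i t) i = clamp t.
Proof. by rewrite /coord /= eqxx. Qed.

Lemma coord_fiber_pt_neq i j t : j != i -> coord (fiber_pt i t) j = f j (r i).
Proof. by move=> /negbTE ji; rewrite /coord /= ji. Qed.

(** Near the fibre over [r i] every coordinate but the [i]-th is nearly constant,
    since [f j] is continuous at [r i].  The radius must also exclude the split
    point [r j], where the [j]-th coordinate is unrestricted. *)
Lemma coord_near i j (delta : R) : j != i -> 0 < delta ->
  \forall e \near 0^'+, forall x, `|base x - r i| <= e ->
    `|coord x j - f j (r i)| < delta.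
Proof.
move=> ji delta0.
have rij : r i != r j.
  by apply: contra_neq ji => /(@sf_point_inj _ _ S) ->.
have /subspace_continuousP/(_ (r i)) := @sf_fun_cts _ _ S j.
move=> /(_ (conj (sf_point01 S i) (elimN eqP rij))).
move=> /cvgrPdist_lt/(_ _ delta0) near_f.
have near_r : \forall z \near r i, z != r j.
  by apply: open_nbhs_nbhs; split => //; exact: open_neq.
have [e /= e0 he] : \forall z \near r i, z != r j /\
    ((`[0, 1] `\ r j) z -> `|f j (r i) - f j z| < delta).
  by move: near_f; rewrite near_withinE => near_f; near=> z; split; near: z.
near=> e' => x xe; have [] : base x != r j /\
    ((`[0, 1] `\ r j) (base x) -> `|f j (r i) - f j (base x)| < delta).
  apply: he => /=; rewrite distrC; apply: le_lt_trans xe _; near: e'.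
  exact: nbhs_right_lt.
move=> xj; rewrite coordE // distrC; apply; split; last exact/eqP.
exact: base_itv.
Unshelve. all: by end_near. Qed.

(** Uniform continuity with respect to finitely many coordinates.  Off the
    diagonal of K * K some coordinate separates the two points, and near the
    diagonal [g] varies little; compactness makes finitely many coordinates and
    one precision enough. *)
Lemma continuous_finite_coords (g : CK R (csi S)) (e : R) : 0 < e ->
  exists (s : seq X) (n : nat), forall x y,
    `|base x - base y| < n.+1%:R^-1 ->
    (forall j, j \in s -> `|coord x j - coord y j| < n.+1%:R^-1) ->
    `|CK_fun g x - CK_fun g y| < e.
Proof.
move=> e0.
pose near_eq (k : seq X * nat) (p : csi S * csi S) :=
  `|base p.1 - base p.2| < k.2.+1%:R^-1 /\
  forall j, j \in k.1 -> `|coord p.1 j - coord p.2 j| < k.2.+1%:R^-1.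
pose P k p := near_eq k p -> `|CK_fun g p.1 - CK_fun g p.2| < e.
(* The conditions [near_eq (s, n)] get stronger as [s] and [n] grow; the filter
   of this directed set of pairs is the one for which compactness is used. *)
pose above (k : seq X * nat) : set (seq X * nat) :=
  [set k' : seq X * nat | {subset k.1 <= k'.1} /\ (k.2 <= k'.2)%N].
pose F := filter_from setT above.
have F_filter : Filter F.
  apply: filter_fromT_filter; first by exists (nil, 0%N).
  move=> [s n] [s' n']; exists (s ++ s', maxn n n') => -[t k] /= [st].
  rewrite geq_max => /andP[nk n'k]; split; split=> //= j js; apply: st;
    by rewrite mem_cat js ?orbT.
have diff_cts (u : csi S -> R) : continuous u ->
    continuous (fun p : csi S * csi S => `|u p.1 - u p.2|).
  move=> cu p; apply: cvg_norm; apply: cvgB.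
    by apply: (@cvg_comp _ _ _ fst u); [exact: cvg_fst|exact: cu].
  by apply: (@cvg_comp _ _ _ snd u); [exact: cvg_snd|exact: cu].
(* A coordinate function [u] that separates the two entries of [p] still does
   so at a definite distance near [p], so that [near_eq k] fails there for large
   [k]. *)
have separate (u : csi S -> R) (s : seq X) (p : csi S * csi S) :
    continuous u -> u p.1 != u p.2 ->
    (forall k q, above (s, 0%N) k -> near_eq k q ->
       `|u q.1 - u q.2| < k.2.+1%:R^-1) ->
    \forall q \near p & k \near F, P k q.
  move=> cu up us; have D0 : 0 < `|u p.1 - u p.2| by rewrite normr_gt0 subr_eq0.
  have [n _ hn] := near_infty_natSinv_lt (PosNum D0).
  have := hn n (leqnn n) => /= Dn.
  exists ([set q | n.+1%:R^-1 < `|u q.1 - u q.2|], above (s, n)).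
    split=> /=; last by exists (s, n).
    exact: (cvgr_gt _ (diff_cts u cu p) _ Dn).
  move=> [q k] /= [qn [sk nk]] kq; exfalso.
  have := us k q (conj sk (leq0n _)) kq; apply/negP; rewrite -leNgt.
  by apply: le_trans (ltW qn); rewrite lef_pV2 ?posrE // ler_nat ltnS.
have /compact_near_coveringP/(_ _ F P F_filter) : compact [set: csi S * csi S].
  by rewrite -setXTT; apply: compact_setX; exact: compact_hausdorff_compact.
case.
  move=> [x y] _; have [xy|xy] := pselect (x = y).
    exists ([set p | `|CK_fun g p.1 - CK_fun g p.2| < e], setT).
      split=> /=; last exact: filterT.
      apply: (cvgr_lt _ (diff_cts (CK_fun g) (@CK_cts _ _ g) (x, y))).
      by rewrite /= xy subrr normr0.
    by move=> [q k] [/= qe _] _.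
  have [bxy|bxy] := eqVneq (base x) (base y); last first.
    by apply: (separate base nil) => //; [exact: base_continuous|move=> k q _ []].
  have [j cxy] : exists j, coord x j != coord y j.
    apply: contrapT => /forallNP all_eq; apply: xy; apply: csi_eq => // j.
    by have /negP := all_eq j; rewrite negbK => /eqP.
  apply: (separate (coord ^~ j) [:: j]) => //; first exact: coord_continuous.
  by move=> k q [jk _] [_]; apply; apply: jk; exact: mem_head.
move=> [s n] _ above_sn; exists s, n => x y bxy cxy.
have sn := above_sn (s, n) (conj (fun _ js => js) (leqnn n)).
exact: (sn (x, y) I (conj bxy cxy)).
Qed.

End csi_coordinates.

(** * Isolating finitely many split points *)

Lemma rat_approx {R : realType} (x e : R) :
  0 < e -> exists q : rat, `|x - ratr q| < e.
Proof.
move=> e0; have [q] := @rat_in_itvoo R (x - e) (x + e) ltac:(lra).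
by rewrite in_itv /= => xq; exists q; rewrite ltr_norml; lra.
Qed.

Definition rat_itv {R : realType} (I : rat * rat) : set R :=
  `]ratr I.1, ratr I.2[%classic.

(** Both the intervals and the approximate values [p (i, j)] of the coordinates
    over them are rational, hence there are only countably many possibilities
    to which a pigeonhole argument applies. *)
Lemma isolating_intervals {R : realType} {X : choiceType}
    (S : splitting_family R X) {m : nat} {J : finType}
    (xi : 'I_m -> X) (e : J -> X) (delta : R) :
  injective xi -> 0 < delta ->
  exists (I : {ffun 'I_m -> rat * rat}) (p : {ffun 'I_m * J -> rat}),
    [/\ forall i, rat_itv (I i) (sf_point S (xi i)),
        forall i k (z : R), rat_itv (I i) z -> rat_itv (I k) z -> i = k &
        forall i (x : csi S), rat_itv (I i) (base S x) ->
          `|base S x - sf_point S (xi i)| < delta /\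
          forall j, e j != xi i ->
            `|coord S x (e j) - ratr (p (i, j))| < delta].
Proof.
move=> xi_inj delta0; pose r i := sf_point S (xi i).
have d2 : 0 < delta / 2 by lra.
have sep : \forall n \near 0^'+, forall i k, i != k -> n *+ 2 < `|r i - r k|.
  apply: filter_forall => i; apply: filter_forall => k.
  have [->|ik] := eqVneq i k; first by apply: filterE.
  have rik : 0 < `|r i - r k|.
    rewrite normr_gt0 subr_eq0; apply: contra_neq ik => rik.
    exact: xi_inj (sf_point_inj rik).
  by near=> n => _; rewrite -mulr_natr -ltr_pdivlMr //; near: n; apply: nbhs_right_lt; rewrite divr_gt0.
have osc : \forall n \near 0^'+, forall i j, e j != xi i -> forall x : csi S,
    `|base S x - r i| <= n -> `|coord S x (e j) - sf_fun S (e j) (r i)| < delta / 2.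
  apply: filter_forall => i; apply: filter_forall => j.
  have [->|ej] := eqVneq (e j) (xi i); first exact: filterE.
  by apply: filterS (coord_near S _ _ _ ej d2) => n hn _.
have [n [n0 nd sep_n osc_n]] : exists n : R, [/\ 0 < n, n < delta,
    forall i k, i != k -> n *+ 2 < `|r i - r k| &
    forall i j, e j != xi i -> forall x : csi S,
    `|base S x - r i| <= n -> `|coord S x (e j) - sf_fun S (e j) (r i)| < delta / 2].
  near (0 : R)^'+ => n; exists n.
  by split; near: n; [exact: nbhs_right_gt|exact: nbhs_right_lt|exact: sep|exact: osc].
have /choice[I hI] : forall i, exists q : rat * rat,
    r i - n < ratr q.1 < r i /\ r i < ratr q.2 < r i + n.
  move=> i.
  have [q] := @rat_in_itvoo R (r i - n) (r i) ltac:(lra).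
  have [q'] := @rat_in_itvoo R (r i) (r i + n) ltac:(lra).
  by rewrite !in_itv /= => q'P qP; exists (q, q').
have /choice[p hp] : forall k : 'I_m * J, exists q : rat,
  `|sf_fun S (e k.2) (r k.1) - ratr q| < delta / 2.
  by move=> k; apply: rat_approx.
have near_I i (z : R) : rat_itv (I i) z -> `|z - r i| < n.
  rewrite /rat_itv /= in_itv /= => zI; have [] := hI i.
  by rewrite ltr_norml => *; lra.
exists (finfun I), (finfun p); split.
- move=> i; rewrite ffunE /rat_itv /= in_itv /= -/(r i); have [] := hI i.
  by move=> /andP[_ ->] /andP[->].
- move=> i k z; rewrite !ffunE => /near_I zi /near_I zk.
  apply/eqP/contraT => /sep_n; rewrite ltNge => /negP; case.
  have -> : r i - r k = (z - r k) - (z - r i) by ring.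
  by apply: le_trans (ler_normB _ _) _; rewrite mulr2n; lra.
move=> i x; rewrite ffunE => /near_I xi_near; split; first exact: lt_trans nd.
move=> j ej; rewrite ffunE; have := osc_n i j ej x (ltW xi_near).
have := hp (i, j) => /= h1 h2.
have -> : coord S x (e j) - ratr (p (i, j)) = (coord S x (e j) - sf_fun S (e j) (r i))
  + (sf_fun S (e j) (r i) - ratr (p (i, j))) by ring.
by apply: le_lt_trans (ler_normD _ _) _; lra.
Unshelve. all: by end_near. Qed.

(** * Uncountably many functions that look alike *)

Lemma free_coords_enum {T : Type} {X : choiceType} (s : T -> seq X) (D : seq X)
    {A : set T} :
  ~ countable A -> exists (m : nat) (B : set T) (xi : T -> 'I_m -> X),
    [/\ B `<=` A, ~ countable B, forall t, B t -> injective (xi t) &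
      forall t, B t -> forall x,
        (x \notin D) && (x \in s t) <-> exists i, xi t i = x].
Proof.
move=> A_unc; pose F t := undup [seq x <- s t | x \notin D].
have [m B_unc] := uncountable_fiber (fun t => size (F t)) A_unc.
pose B := A `&` [set t | size (F t) = m].
have enum t : B t -> exists xi : 'I_m -> X, injective xi /\
    forall x, (x \notin D) && (x \in s t) <-> exists i, xi i = x.
  move=> [_ /= Fm]; exists (fun i => tnth (in_tuple (F t)) (cast_ord (esym Fm) i)).
  have Ft_uniq : uniq (in_tuple (F t)) by exact: undup_uniq.
  split.
    move=> i k /(elimT (tuple_uniqP _) Ft_uniq) /(congr1 (@nat_of_ord _)) /= ik.
    exact: val_inj.
  move=> x; have -> : (x \notin D) && (x \in s t) = (x \in F t).
    by rewrite mem_undup mem_filter.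
  split=> [/(tnthP (in_tuple (F t)))[i ->]|[i <-]].
    by exists (cast_ord Fm i); rewrite cast_ordK.
  exact: mem_tnth.
have [t0 Bt0] : B !=set0.
  apply: contrapT => /set0P/negP; rewrite negbK => /eqP B0.
  by apply: B_unc; rewrite -/B B0; exact: countable0.
have [xi0 _] := enum t0 Bt0.
have /choice[xi hxi] : forall t, exists xi : 'I_m -> X, B t -> injective xi /\
    forall x, (x \notin D) && (x \in s t) <-> exists i, xi i = x.
  move=> t; have [Bt|nBt] := pselect (B t); last by exists xi0.
  by have [xi] := enum t Bt; exists xi.
exists m, B, xi; split=> // [t []//|t Bt|t Bt x]; have [] := hxi t Bt => //.
Qed.

(** The private coordinates of [g a] are the [xi a i]; see the introduction.  The
    functions [psi i] come from a single member [h] of the thinned family: they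
    are its restrictions to the fibres over its own private split points. *)
Lemma coherent_family {R : realType} {d : Order.disp_t} {W : orderType d}
    {X : choiceType} (S : splitting_family R X) {A : set (CK R (csi S))}
    {eps : R} :
  is_omega1 W -> ~ countable A -> 0 < eps ->
  exists (m : nat) (I : 'I_m -> rat * rat) (g : W -> CK R (csi S))
      (xi : W -> 'I_m -> X) (psi : 'I_m -> R -> R),
    [/\ (forall a, A (g a)) /\ (forall a b, (a < b)%O -> g a <> g b),
      trivIset [set: W] (fun a => range (xi a)),
      (forall i k (z : R), rat_itv (I i) z -> rat_itv (I k) z -> i = k) /\
        (forall a i, rat_itv (I i) (sf_point S (xi a i))),
      (forall i, continuous (psi i)) /\
        (exists2 h, A h & forall i t, exists y, psi i t = CK_fun h y) &
      (forall a i x, rat_itv (I i) (base S x) ->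
          `|CK_fun (g a) x - psi i (coord S x (xi a i))| < eps) /\
        (forall a b x, (forall i, coord S x (xi a i) = coord S x (xi b i)) ->
          `|CK_fun (g a) x - CK_fun (g b) x| < eps)].
Proof.
move=> W_omega1 A_unc eps0; have e2 : 0 < eps / 2 by lra.
have /choice[sn hsn] : forall g : CK R (csi S), exists sn : seq X * nat,
    forall x y, `|base S x - base S y| < sn.2.+1%:R^-1 ->
    (forall j, j \in sn.1 -> `|coord S x j - coord S y j| < sn.2.+1%:R^-1) ->
    `|CK_fun g x - CK_fun g y| < eps / 2.
  by move=> g; have [s [n hs]] := continuous_finite_coords S g _ e2; exists (s, n).
pose s g := (sn g).1.
have [[n l] A1_unc] := uncountable_fiber (fun g => ((sn g).2, size (s g))) A_unc.
have [|D [A2 [A2A1 A2_unc A2D]]] := delta_root l s A1_unc.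
  by move=> g [_ /= [_ ->]].
have [m [A3 [xi [A3A2 A3_unc xi_inj xiP]]]] := free_coords_enum s D A2_unc.
(* The coordinates of [g]: those in the root, then the private ones. *)
pose J : finType := ('I_(size D) + 'I_m)%type.
pose e g (j : J) : X :=
  match j with inl k => tnth (in_tuple D) k | inr i => xi g i end.
have e_free g j i : A3 g -> j != inr i -> e g j != xi g i.
  move=> A3g; case: j => [k|k] /= ji; last first.
    by apply: contra_neq ji => /(xi_inj g A3g) ->.
  have /andP[xD _] : (xi g i \notin D) && (xi g i \in s g).
    by apply/(xiP g A3g); exists i.
  by apply: contraNneq xD => <-; exact: mem_tnth.
have e_onto g x : A3 g -> x \in s g -> exists j, e g j = x.
  move=> A3g xs; have [xD|xD] := boolP (x \in D).
    by have /(tnthP (in_tuple D))[k ->] := xD; exists (inl k).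
  have /(xiP g A3g)[i <-] : (x \notin D) && (x \in s g) by rewrite xD.
  by exists (inr i).
(* A quarter of the precision of uniform continuity: in [close] below one unit is
   spent on passing from [g] to [h] and three on moving from [x] to [y]. *)
pose delta : R := n.+1%:R^-1 / 4.
have delta0 : 0 < delta by rewrite divr_gt0 // invr_gt0.
pose isolates g (Ip : {ffun 'I_m -> rat * rat} * {ffun 'I_m * J -> rat}) :=
  [/\ forall i, rat_itv (Ip.1 i) (sf_point S (xi g i)),
      forall i k (z : R), rat_itv (Ip.1 i) z -> rat_itv (Ip.1 k) z -> i = k &
      forall i (x : csi S), rat_itv (Ip.1 i) (base S x) ->
        `|base S x - sf_point S (xi g i)| < delta /\
        forall j, e g j != xi g i -> `|coord S x (e g j) - ratr (Ip.2 (i, j))| < delta].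
have /choice[Ip hIp] : forall g, exists Ip, A3 g -> isolates g Ip.
  move=> g; have [A3g|nA3g] := pselect (A3 g); last first.
    by exists ([ffun=> (0, 0)], [ffun=> 0]).
  have [I [p hI]] := isolating_intervals S (xi g) (e g) delta (xi_inj g A3g) delta0.
  by exists (I, p).
have [[I p] A4_unc] := uncountable_fiber Ip A3_unc.
pose A4 := A3 `&` [set g | Ip g = (I, p)].
have A4P g : A4 g -> isolates g (I, p) by move=> [/hIp + /= <-].
pose u (g : CK R (csi S)) (x : csi S) (o : option (option J)) : R :=
  match o with None => CK_fun g x | Some None => base S x
             | Some (Some j) => coord S x (e g j) end.
have min0 : 0 < Num.min delta (eps / 2) by rewrite lt_min delta0.
(* The value of [g] is one more coordinate of the graph, so that closeness of
   graphs compares the functions and their coordinates at the same time. *)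
have [|A5 [A5A4 A5_unc A5P]] := uncountable_close_graphs u min0 A4_unc.
  move=> g _; exists (Num.max `|g| 1) => x; case=> [[j|]|] /=.
  - by rewrite le_max [X in _ || X]ler_norml coord_itv orbT.
  - have := base_itv S x; rewrite /= in_itv /= => /andP[x0 x1].
    by rewrite le_max ger0_norm // x1 orbT.
  - by rewrite le_max CK_le_norm.
have A5A3 g : A5 g -> A3 g by move=> /A5A4[].
have A3E g : A3 g -> (sn g).2 = n.
  by move=> /A3A2/A2A1[_ /= []].
(* Members of [A5] are nearly the same function of their own coordinates. *)
have close g h x y : A5 g -> A5 h -> `|base S x - base S y| < 3 * delta ->
    (forall j, `|coord S x (e g j) - coord S y (e h j)| < 3 * delta) ->
    `|CK_fun g x - CK_fun h y| < eps.
  move=> A5g A5h bxy cxy; have [z hz] := A5P g h x A5g A5h.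
  have := hz None; rewrite lt_min /= => /andP[_ gh].
  have n4 : n.+1%:R^-1 = delta + 3 * delta by rewrite /delta; field.
  have zy : `|CK_fun h z - CK_fun h y| < eps / 2.
    apply: hsn; rewrite (A3E h (A5A3 h A5h)) n4.
      have := hz (Some None); rewrite lt_min /= => /andP[xz _].
      apply: le_lt_trans (ler_distD (base S x) _ _) _.
      by rewrite (distrC (base S z)) ltrD.
    move=> x' /(e_onto h _ (A5A3 h A5h))[j <-].
    have := hz (Some (Some j)); rewrite lt_min /= => /andP[xz _].
    apply: le_lt_trans (ler_distD (coord S x (e g j)) _ _) _.
    by rewrite (distrC (coord S z (e h j))) ltrD.
  apply: le_lt_trans (ler_distD (CK_fun h z) _ _) _; lra.
(* The private coordinates of [g] are outside of the root, so each of them is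
   shared with only countably many other members. *)
pose conflict (g h : CK R (csi S)) := g = h \/ exists i k, xi g i = xi h k.
have [|g A5g g_free] := transfinite_avoid conflict W_omega1 A5_unc.
  move=> g A5g; apply: (@countable_subset _ _ ([set g] `|`
      \bigcup_(i in [set: 'I_m]) (A2 `&` [set h | xi g i \in s h]))).
    move=> h [A5h [gh|[i [k ik]]]]; first by left.
    right; exists i => //; split; first exact: A3A2 (A5A3 h A5h).
    have /andP[_ xs] : (xi h k \notin D) && (xi h k \in s h).
      by apply/(xiP h (A5A3 h A5h)); exists k.
    by rewrite /= ik.
  rewrite -bigcup2E; apply: bigcup_countable => // -[|[|k]] _ /=.
  - exact: countable1.
  - apply: bigcup_countable => // i _; apply: A2D.
    have /andP[xD _] : (xi g i \notin D) && (xi g i \in s g).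
      by apply/(xiP g (A5A3 g A5g)); exists i.
    exact: xD.
  - exact: countable0.
have [h A5h] : A5 !=set0.
  apply: contrapT => /set0P/negP; rewrite negbK => /eqP B0.
  by apply: A5_unc; rewrite B0; exact: countable0.
pose psi i t := CK_fun h (fiber_pt S (xi h i) t).
have A5A f : A5 f -> A f by move=> /A5A3/A3A2/A2A1[].
exists m, I, g, (fun a => xi (g a)), psi; split.
- split=> [a|a b ab gab]; first exact: A5A.
  by apply: (g_free a b ab); left.
- apply/trivIsetP => a b _ _ ab; apply/seteqP; split=> // x [[i _ ix] [k _ kx]].
  have [ab'|ba|/eqP] := ltgtP a b; last by rewrite (negbTE ab).
    by apply: (g_free a b ab'); right; exists i, k; rewrite ix kx.
  by apply: (g_free b a ba); right; exists k, i; rewrite ix kx.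
- have [_ disj _] := A4P h (A5A4 h A5h); split=> // a i.
  by have [] := A4P (g a) (A5A4 _ (A5g a)).
- split; last first.
    by exists h; [exact: A5A|move=> i t; exists (fiber_pt S (xi h i) t)].
  move=> i t; apply/cvgrPdist_lt => e' e'0.
  have [s' [n' hs']] := continuous_finite_coords S h _ e'0.
  have n'0 : 0 < n'.+1%:R^-1 :> R by rewrite invr_gt0.
  near=> t'; apply: hs'; first by rewrite !base_fiber_pt subrr normr0.
  move=> j _; have [->|ji] := eqVneq j (xi h i).
    rewrite !coord_fiber_pt; apply: le_lt_trans (clamp_dist _ _) _; near: t'.
    by apply: cvgr_dist_lt => //; exact: cvg_id.
  by rewrite !coord_fiber_pt_neq // subrr normr0.
split=> [a i x xI|a b x xab].
  have [_ _ /(_ i x xI) [_ gx]] := A4P (g a) (A5A4 _ (A5g a)).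
  have [hI _ hosc] := A4P h (A5A4 h A5h).
  have [_ hy] := hosc i (fiber_pt S (xi h i) (coord S x (xi (g a) i))) (hI i).
  have [bx _] := hosc i x xI.
  (* The point [x] is compared with the point at the same height of the fibre
     of [h]: the [i]-th private coordinates are equal, and the other coordinates
     of both points are within [delta] of the common value [p (i, j)]. *)
  apply: close => //; first by rewrite base_fiber_pt; lra.
  move=> j; have [->|ji] := eqVneq j (inr i).
    by rewrite /= coord_fiber_pt clamp_id ?coord_itv // subrr normr0; lra.
  have := gx j (e_free _ _ _ (A5A3 _ (A5g a)) ji).
  have := hy j (e_free _ _ _ (A5A3 _ A5h) ji).
  move=> hyj gxj; apply: le_lt_trans (ler_distD (ratr (p (i, j))) _ _) _.
  by rewrite distrC in hyj; move: hyj gxj => /=; lra.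
apply: close => //; first by rewrite subrr normr0; lra.
by case=> [k|i] /=; rewrite ?xab subrr normr0; lra.
Unshelve. all: by end_near. Qed.

(** * Oscillation and distances *)

Lemma rat_value_approx {R : realType} (psi : R -> R) (t e : R) :
  continuous psi -> -1 <= t <= 1 -> 0 < e ->
  exists2 q : rat, -1 <= q <= 1 & `|psi t - psi (ratr q)| < e.
Proof.
move=> psi_cts t1 e0.
have /cvgrPdist_lt/(_ _ e0)[d /= d0 hd] := psi_cts t.
have [q] := @rat_in_itvoo R (Num.max (-1) (t - d)) (Num.min 1 (t + d))
  ltac:(rewrite gt_max !lt_min; lra).
rewrite in_itv /= gt_max lt_min => /andP[/andP[q1 qt] /andP[q2 qt']].
exists q; last by apply: hd; rewrite /= ltr_norml; lra.
by rewrite -2!(ler_rat R) rmorphN rmorph1; lra.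
Qed.

(** A continuous image of [[-1, 1]] is an interval and so contains the midpoint
    between the maximum and the minimum.  This is where connectedness of the
    fibres matters. *)
Lemma rat_midrange {R : realType} (psi : R -> R) (C e : R) :
  continuous psi ->
  (forall s t, -1 <= s <= 1 -> -1 <= t <= 1 -> psi s - psi t <= C) -> 0 < e ->
  exists2 q : rat, -1 <= q <= 1 &
    forall s, -1 <= s <= 1 -> `|psi (ratr q) - psi s| <= C / 2 + e.
Proof.
move=> psi_cts osc e0.
have psi_sub (a b : R) : {within `[a, b], continuous psi}.
  exact: continuous_subspaceT.
have N11 : -1 <= 1 :> R by lra.
have [s1] := EVT_max N11 (psi_sub _ _); rewrite in_itv /= => s1I max1.
have [s0] := EVT_min N11 (psi_sub _ _); rewrite in_itv /= => s0I min0.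
have [c c1 psi_c] : exists2 c, -1 <= c <= 1 & psi c = (psi s0 + psi s1) / 2.
  have s01 : psi s0 <= psi s1 by apply: max1; rewrite in_itv.
  have [s|s] := leP s0 s1.
    have [|c] := IVT (v := (psi s0 + psi s1) / 2) s (psi_sub _ _).
      by rewrite ge_min le_max; lra.
    by rewrite in_itv /= => cI; exists c => //; lra.
  have [|c] := IVT (v := (psi s0 + psi s1) / 2) (ltW s) (psi_sub _ _).
    by rewrite ge_min le_max; lra.
  by rewrite in_itv /= => cI; exists c => //; lra.
have [q q1 hq] := rat_value_approx psi c e psi_cts c1 e0.
exists q => // s sI; have := osc s1 s0 s1I s0I.
have := max1 s; have := min0 s; rewrite in_itv /= => /(_ sI) h1 /(_ sI) h2.
move: hq; rewrite psi_c ltr_norml ler_norml; lra.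
Qed.

(** The two opposite consequences of the anti-Ramsey property: distances as large
    as the oscillation of [psi i] occur, and so do distances no larger than half
    of the largest oscillation. *)
Lemma anti_ramsey_oscillation {R : realType} {d : Order.disp_t}
    {W : orderType d} {X : choiceType} (S : splitting_family R X)
    {A : set (CK R (csi S))} {eps : R} :
  is_omega1 W -> anti_ramsey W S -> ~ countable A -> 0 < eps ->
  exists (m : nat) (psi : 'I_m -> R -> R),
    [/\ exists2 h, A h & forall i t, exists y, psi i t = CK_fun h y,
      forall i s t, -1 <= s <= 1 -> -1 <= t <= 1 ->
        exists f g, [/\ A f, A g, f <> g & psi i s - psi i t <= `|f - g| + eps] &
      forall C, 0 <= C ->
        (forall i s t, -1 <= s <= 1 -> -1 <= t <= 1 -> psi i s - psi i t <= C) ->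
        exists f g, [/\ A f, A g, f <> g & `|f - g| <= C / 2 + eps]].
Proof.
move=> W_omega1 S_ar A_unc eps0; have e0 : 0 < eps / 4 by lra.
have [m [I [g [xi [psi [[gA g_neq] xi_disj [I_disj I_xi] [psi_cts psi_val] [gE g_agree]]]]]]] :=
  coherent_family S W_omega1 A_unc e0.
pose I' i : set R := rat_itv (I i) `&` `[0, 1].
have I'xi a i : I' i (sf_point S (xi a i)).
  by split; [exact: I_xi|exact: sf_point01].
have [w _] : [set: W] !=set0.
  apply: contrapT => /set0P/negP; rewrite negbK => /eqP W0.
  by case: W_omega1 => _ + _; rewrite W0; apply; exact: countable0.
have I'0 i : I' i !=set0 by exists (sf_point S (xi w i)).
have I'rat i : rat_open_interval01 (I' i) by exists (I i).1, (I i).2.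
have I'disj : trivIset [set: 'I_m] I'.
  apply/trivIsetP => i k _ _ ik; apply/seteqP; split=> // z [[zi _] [zk _]].
  by move: ik; rewrite (I_disj i k z zi zk) eqxx.
have ar := S_ar m I' I'rat I'0 I'disj xi xi_disj I'xi.
have eval j (x : csi S) (U V : set R) (q : rat) : U (sf_point S j) ->
    U `&` V = set0 -> (forall z, V z -> sf_fun S j z = ratr q) ->
    V (base S x) -> coord S x j = ratr q.
  move=> Uj UV fV Vx; rewrite coordE ?fV //; apply/eqP => xj.
  have : (U `&` V) (base S x) by split; rewrite // xj.
  by rewrite UV.
exists m, psi; split=> //.
  move=> i s t sI tI.
  have [q q1 hq] := rat_value_approx (psi i) t _ (psi_cts i) tI e0.
  have [a [b [ab [J [J' [_ /(_ i)]]]]]] := ar (fun=> q) (fun=> q) (fun=> q1) (fun=> q1).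
  move=> [[JI J'I JJ'] [Ja J'b] _ _ fb].
  exists (g a), (g b); split => //; first exact: g_neq.
  (* Over the split point of [xi a i], the coordinate [xi b i] is frozen at [q],
     while [xi a i] can be given the value [s]. *)
  pose x := fiber_pt S (xi a i) s.
  have xb : coord S x (xi b i) = ratr q.
    by apply: (eval _ _ (J' i) (J i)) => //; rewrite setIC.
  have [xI _] : I' i (base S x) := I'xi a i.
  have := gE a i x xI; have := gE b i x xI.
  rewrite xb coord_fiber_pt clamp_id // => hb ha.
  have : `|CK_fun (g a) x - CK_fun (g b) x| <= `|g a - g b|.
    exact: (CK_le_norm (g a - g b) x).
  by move: ha hb hq; rewrite !ltr_norml ler_norml; lra.
move=> C C0 osc.
have /choice[q hq] : forall i, exists q : rat, -1 <= q <= 1 /\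
    forall s, -1 <= s <= 1 -> `|psi i (ratr q) - psi i s| <= C / 2 + eps / 4.
  move=> i.
  by have [q] := rat_midrange (psi i) C _ (psi_cts i) (osc i) e0; exists q.
have q1 i := (hq i).1.
have [a [b [ab [J [J' [_ JJ']]]]]] := ar q q q1 q1.
exists (g a), (g b); split=> //; first exact: g_neq.
apply/CK_norm_le => [|x]; first by lra.
rewrite CK_addE CK_oppE.
(* Over [J i] or [J' i] one of the two private coordinates has the midrange value
   of [psi i]; elsewhere all private coordinates of [g a] and [g b] agree. *)
have [[i Ji]|nJ] := pselect (exists i, (J i `|` J' i) (base S x)).
  have [[JI J'I JJ'0] [Ja J'b] _ fa fb] := JJ' i.
  have [xI _] : I' i (base S x) by case: Ji => [/JI|/J'I].
  have := gE a i x xI; have := gE b i x xI.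
  case: Ji => [Jx|J'x].
    have -> : coord S x (xi b i) = ratr (q i).
      by apply: (eval _ _ (J' i) (J i)) => //; rewrite setIC.
    have := (hq i).2 _ (coord_itv S x (xi a i)).
    rewrite !ltr_norml !ler_norml; lra.
  have -> : coord S x (xi a i) = ratr (q i) by exact: (eval _ _ (J i) (J' i)).
  have := (hq i).2 _ (coord_itv S x (xi b i)).
  rewrite !ltr_norml !ler_norml; lra.
apply: (@le_trans _ _ (eps / 4)); last by lra.
apply/ltW/g_agree => i; have [_ [Ja J'b] f_agree _ _] := JJ' i.
have nJi : ~ (J i `|` J' i) (base S x) by move=> Ji; apply: nJ; exists i.
rewrite !coordE; first by apply: f_agree; split=> //; exact: base_itv.
  by apply/eqP => xb; apply: nJi; right; rewrite xb.
by apply/eqP => xa; apply: nJi; left; rewrite xa.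
Qed.

Theorem theorem3p3 (R : realType) (d : Order.disp_t) (W : orderType d)
    (W_omega1 : is_omega1 W) (S : splitting_family R W)
    (S_anti_ramsey : anti_ramsey W S) :
  ~ (exists A : set (CK R (csi S)), equilateral A /\ ~ countable A) /\
  (forall eps : R, 0 < eps ->
    ~ (exists A : set (CK R (csi S)),
        [/\ A `<=` [set g | `|g| <= 1],
            r_separated (1 + eps) A &
            ~ countable A])).
Proof.
split=> [[A [[r A_r] A_unc]]|eps eps0 [A [A_ball A_sep A_unc]]].
  have r0 : 0 < r.
    rewrite ltNge; apply/negP => r_le0; apply: A_unc.
    have [[f Af]|A0] := pselect (A !=set0).
      apply: (@countable_subset _ _ [set f]); last exact: countable1.
      move=> g Ag; apply: contrapT => gf; have := A_r g f Ag Af gf => gfr.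
      by apply/gf/eqP; rewrite -subr_eq0 -normr_le0 gfr.
    by apply: (@countable_subset _ _ set0) => // f Af; apply: A0; exists f.
  have [m [psi [_ lower upper]]] := anti_ramsey_oscillation S W_omega1
    S_anti_ramsey A_unc (divr_gt0 r0 (ltr0n _ 8)).
  have [||f [g [Af Ag fg]]] := upper (r + r / 8); first by lra.
    move=> i s t sI tI; have [f [g [Af Ag fg]]] := lower i s t sI tI.
    by rewrite (A_r f g).
  by rewrite (A_r f g) //; lra.
have e0 : 0 < eps / 2 by lra.
have [m [psi [[h Ah psi_h] _ upper]]] := anti_ramsey_oscillation S W_omega1
  S_anti_ramsey A_unc e0.
have [||f [g [Af Ag fg]]] := upper 2; first by lra.
  move=> i s t _ _; have [x ->] := psi_h i s; have [y ->] := psi_h i t.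
  have := CK_le_norm h x; have := CK_le_norm h y; have : CK_norm h <= 1 := A_ball h Ah.
  by rewrite !ler_norml; move: (CK_norm h) => n *; lra.
by apply/negP; rewrite -ltNge; apply: le_lt_trans (A_sep f g Af Ag fg); lra.
Qed.
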